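(* Let $(P,<)$ be a finite poset with $n \geq 1$ elements. Then there is a finite poset $(Q,<_Q)$ with $P \subseteq Q$, $|Q \setminus P| \leq \lceil (n+1)/2 \rceil$, such that the restriction of $<_Q$ to $P$ equals $<$ and $(Q,<_Q)$ is simple.
   Context: An interval of a poset $(Q,<_Q)$ is a set $I \subseteq Q$ such that for all $x,y \in I$ and all $z \in Q \setminus I$: $z <_Q x \iff z <_Q y$ and $x <_Q z \iff y <_Q z$. The empty set, singletons and $Q$ are intervals; other intervals are proper. A poset is simple if it has no proper intervals. *)

(* Defs.v *)
From mathcomp Require Import all_boot all_order.

Set Implicit Arguments.
Unset Strict Implicit.
Unset Printing Implicit Defensive.

Import Order.TTheory.

(* Order-theoretic modules (autonomous sets), not the intervals [a, b] of
   mathcomp's interval library. *)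
Definition poset_interval d (Q : finPOrderType d) (I : {set Q}) : Prop :=
  forall x y z : Q, x \in I -> y \in I -> z \notin I ->
    ((z < x)%O <-> (z < y)%O) /\ ((x < z)%O <-> (y < z)%O).

Definition proper_poset_interval d (Q : finPOrderType d) (I : {set Q}) : Prop :=
  [/\ poset_interval I, I <> set0, (forall x : Q, I <> [set x])
    & I <> [set: Q]].

Definition simple_poset d (Q : finPOrderType d) : Prop :=
  forall I : {set Q}, ~ proper_poset_interval I.

(* Main.v *)
(* Call two elements twins if all other elements compare with them in the same
   way. By induction on the number of elements, it suffices to extend P after
   removing from it either one element and adding nothing, or two elements and
   adding one new point.
   - If a is not a twin of another element and is neither the top, nor the
     bottom, nor isolated, amalgamate a freely with a simple extension S of
     P - a. Either the result is simple, or a is a clone of some z in S - P,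
     and then z can play the role of a.
   - If {a, p} and {b, q} are disjoint pairs of twins, take a simple extension S
     of P - a - b and add a and b as clones of p and q: the only proper
     intervals are now the two pairs, and one new point can separate both.
   - If {b, q} is a pair of twins and a is top, bottom or isolated, a new point
     can separate b from q and at the same time compare with a otherwise than S
     does.
   From four elements on one of these cases applies; posets with two or three
   elements embed in the 4-element N or the 5-element bull. *)
From HB Require Import structures.
Require Import Defs.
From mathcomp Require Import all_boot all_order.
From mathcomp Require Import zify.

Set Implicit Arguments.
Unset Strict Implicit.
Unset Printing Implicit Defensive.

Import Order.TTheory.

(** * Intervals, twins and simplicity for bare relations *)

(* Intervals and twins only depend on how pairs compare, recorded by [code]. *)
Definition code (T : Type) (r : rel T) (x y : T) := (r x y, r y x).

Definition strict (T : Type) (r : rel T) := irreflexive r /\ transitive r.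

Definition module (T : finType) (r : rel T) (I : {set T}) :=
  forall x y w, x \in I -> y \in I -> w \notin I -> code r w x = code r w y.

Definition simple_rel (T : finType) (r : rel T) :=
  forall I : {set T}, module r I -> #|I| <= 1 \/ I = setT.

(** For [x] and [y] in [P], this makes {x, y} an interval of the restriction of [r] to [P],
    whichever way [x] and [y] compare with each other. *)
Definition twin (T : eqType) (r : rel T) (P : pred T) (x y : T) :=
  forall w, P w -> w != x -> w != y -> code r w x = code r w y.

Lemma codeC (T : Type) (r : rel T) x y x' y' :
  code r x y = code r x' y' -> code r y x = code r y' x'.
Proof. by rewrite /code => -[-> ->]. Qed.

Lemma twinC (T : eqType) (r : rel T) (P : pred T) x y :
  twin r P x y -> twin r P y x.
Proof. by move=> H w Pw wy wx; rewrite H. Qed.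

(** Otherwise {p, q} would be an interval with two elements, and it is not everything because [T]
    has more. *)
Lemma simple_no_twin (T : finType) (r : rel T) (p q : T) :
  simple_rel r -> 2 < #|T| -> p != q ->
  exists w, [/\ w != p, w != q & code r w p <> code r w q].
Proof.
move=> simp cT pq; case: (pickP (fun w => [&& w != p, w != q &
  code r w p != code r w q])) => [w /and3P[wp wq /eqP wpq]|none]; first by exists w.
case: (simp [set p; q]) => [||E].
- move=> x y w; rewrite !inE negb_or => xpq ypq /andP[wp wq].
  have /eqP E : code r w p == code r w q.
    by move: (none w); rewrite wp wq /=; case: eqP.
  by case/orP: xpq => /eqP->; case/orP: ypq => /eqP->.
- by rewrite cards2 pq.
- by move: cT; rewrite -cardsT -E cards2 pq.
Qed.

(** Otherwise the complement of [p] would be an interval with at least two elements. *)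
Lemma simple_not_uniform (T : finType) (r : rel T) (p : T) :
  simple_rel r -> 2 < #|T| ->
  exists w w', [/\ w != p, w' != p & code r p w <> code r p w'].
Proof.
move=> simp cT; case: (pickP (fun ww : T * T => [&& ww.1 != p, ww.2 != p &
  code r p ww.1 != code r p ww.2])) => [[w w'] /and3P[/= wp wq /eqP wpq]|none].
  by exists w, w'.
case: (simp [set~ p]) => [||E].
- move=> x y w; rewrite !inE negbK => xp yp /eqP->.
  by move: (none (x, y)); rewrite /= xp yp /=; case: eqP.
- by rewrite cardsC1; lia.
- by have: p \in [set~ p]; [rewrite E | rewrite !inE eqxx].
Qed.

(** The simplicity proofs below start from this trace of an interval: on a simple relation it is
    everything or has at most one point. *)
Lemma preim_module (S R : finType) (s : rel S) (r : rel R) (g : S -> R) I :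
  (forall x y, code r (g x) (g y) = code s x y) ->
  module r I -> module s (g @^-1: I).
Proof. by move=> gE mI x y w; rewrite !inE -!gE; exact: mI. Qed.

Lemma card_le1_of (T : finType) (I : {set T}) :
  (forall x y, x \in I -> y \in I -> x != y -> False) -> #|I| <= 1.
Proof.
move=> H; apply/card_le1_eqP => x y xI yI; apply/eqP/negPn/negP => xy.
exact: (H y x).
Qed.

(** * One-point extensions *)

Definition oext (T : Type) (r : rel T) (D U : pred T) : rel (option T) :=
  fun x y => match x, y with
  | Some x, Some y => r x y
  | Some x, None => D x
  | None, Some y => U y
  | None, None => false
  end.

(** Transitivity for the triples that involve the new point once. Irreflexivity of [r] then makes
    [D] and [U] disjoint, which excludes None < y < None. *)
Definition oext_ok (T : Type) (r : rel T) (D U : pred T) :=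
  [/\ forall x y, r x y -> D y -> D x,
      forall x y, r x y -> U x -> U y
    & forall x y, D x -> U y -> r x y].

Lemma oext_strict (T : Type) (r : rel T) (D U : pred T) :
  strict r -> oext_ok r D U -> strict (oext r D U).
Proof.
move=> [irr tr] [dD uU DU]; split; first by case=> //= x; exact: irr.
move=> [y|] [x|] [z|] //=.
- exact: tr.
- exact: dD.
- by move=> Ux ryz; apply: uU ryz Ux.
- by move=> Uy Dy; move: (DU _ _ Dy Uy); rewrite irr.
- exact: DU.
Qed.

(** If the trace of an interval on [S] is everything, the new point is inside, since it does not
    compare uniformly with [S]. If the trace is one point, the new point is outside, since it has no
    twin in [S]. *)
Lemma simple_oext (S : finType) (s : rel S) (D U : pred S) :
  simple_rel s -> 2 < #|S| ->
  (exists x y, (U x, D x) <> (U y, D y)) ->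
  (forall q, exists2 w, w != q & code s w q <> (D w, U w)) ->
  simple_rel (oext s D U).
Proof.
move=> simp cS [x0 [y0 nt]] ntw I mI.
have mJ : module s (Some @^-1: I) by exact: preim_module mI.
case: (simp _ mJ) => [|JT].
  move/card_le1_eqP => J1; left; apply: card_le1_of.
  have key x : Some x \in I -> None \in I -> False.
    move=> xI nI; have [w wx] := ntw x; apply.
    apply: (mI (Some x) None (Some w)) => //.
    apply/negP => wI; case/eqP: wx; apply: J1; by rewrite inE.
  move=> [x|] [y|] xI yI // xy; [|by case: (key x)|by case: (key y)].
  by case/eqP: xy; congr Some; apply: J1; rewrite inE.
have Is x : Some x \in I by move: (in_setT x); rewrite -JT inE.
right; apply/setP => -[x|]; rewrite inE ?Is //.
apply/negPn/negP => nI; case: nt.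
exact: (mI (Some x0) (Some y0) None).
Qed.

(** * Simplicity of extensions by three points *)

Local Notation inX x := (Some (Some (Some x))).
Local Notation na := (Some (Some None)).
Local Notation nb := (Some None).

(** [None] separates each clone from its original. An interval with full trace on [S] contains both
    clones, as [p] and [q] do not compare uniformly with [S], and hence [None]. One with smaller
    trace cannot meet both pairs, as a point of [S] distinguishes [p] from [q]. *)
Lemma simple_two_clones (S : finType) (s : rel S) (p q : S)
    (r : rel (option (option (option S)))) :
  simple_rel s -> 2 < #|S| -> p != q ->
  (forall x y, code r (inX x) (inX y) = code s x y) ->
  twin r isSome na (inX p) -> twin r isSome nb (inX q) ->
  code r None na <> code r None (inX p) ->
  code r None nb <> code r None (inX q) ->
  simple_rel r.
Proof.
move=> simp cS pq rE twa twb sepa sepb I mI.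
have mJ : module s ((fun x => inX x) @^-1: I) by exact: preim_module mI.
have aw w : w != p -> code r (inX w) na = code s w p.
  by move=> wp; rewrite twa ?rE //; apply: contra_neq wp => -[].
have bw w : w != q -> code r (inX w) nb = code s w q.
  by move=> wp; rewrite twb ?rE //; apply: contra_neq wp => -[].
case: (simp _ mJ) => [|JT]; last first.
  have Is x : inX x \in I by move: (in_setT x); rewrite -JT inE.
  have aI : na \in I.
    apply/negPn/negP => nI.
    have [w [w' [wp wp']]] := simple_not_uniform p simp cS; apply.
    apply: codeC; rewrite -!aw //; apply: codeC; exact: mI.
  have bI : nb \in I.
    apply/negPn/negP => nI.
    have [w [w' [wp wp']]] := simple_not_uniform q simp cS; apply.
    apply: codeC; rewrite -!bw //; apply: codeC; exact: mI.
  right; apply/setP => -[[[x|]|]|]; rewrite inE ?Is //.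
  by apply/negPn/negP => nI; case: sepa; exact: mI.
move/card_le1_eqP => J1; left.
have {}J1 x y : inX x \in I -> inX y \in I -> x = y.
  by move=> xI yI; apply: J1; rewrite inE.
have Jn x w : inX x \in I -> w != x -> inX w \notin I.
  by move=> xI; apply: contra_neqN => wI; exact: J1.
(* For another [c], a point of [S] that distinguishes [p] from [c] lies outside [I] and would
   distinguish [na] from [inX c]. *)
have Ga c : na \in I -> inX c \in I -> p = c.
  move=> aI cI; apply/eqP/negPn/negP => pc.
  have [w [wp wc]] := simple_no_twin simp cS pc; apply.
  by rewrite -(aw w wp) -(rE w c); apply: mI => //; exact: Jn cI _.
have Gb c : nb \in I -> inX c \in I -> q = c.
  move=> bI cI; apply/eqP/negPn/negP => pc.
  have [w [wp wc]] := simple_no_twin simp cS pc; apply.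
  by rewrite -(bw w wp) -(rE w c); apply: mI => //; exact: Jn cI _.
have K a' b' : a' \in [:: na; inX p] -> b' \in [:: nb; inX q] ->
    a' \in I -> b' \in I -> False.
  move=> a'E b'E a'I b'I.
  have [w [wp wq]] := simple_no_twin simp cS pq; apply.
  have -> : code s w p = code r (inX w) a'.
    by move: a'E; rewrite !inE => /orP[]/eqP->; rewrite ?aw ?rE.
  have -> : code s w q = code r (inX w) b'.
    by move: b'E; rewrite !inE => /orP[]/eqP->; rewrite ?bw ?rE.
  apply: mI => //; apply/negP => wI.
  move: a'E; rewrite !inE => /orP[]/eqP E; rewrite E in a'I.
    by case/eqP: wp; rewrite (Ga w).
  by case/eqP: wp; exact: J1.
apply: card_le1_of => e e' eI e'I ee'.
have [zI|zI] := boolP (None \in I).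
  have [t tz tI] : exists2 t, t != None & t \in I.
    by case: (eqVneq e None) => [E|ne]; [exists e'; rewrite // -E eq_sym | exists e].
  (* If [na] and [inX p] were both outside [I], they would compare alike with [t], hence also with
     [None], against [sepa]. So [I] meets both pairs, which [K] excludes. *)
  have [a' a'E a'I] : exists2 a', a' \in [:: na; inX p] & a' \in I.
    have [aI|aI] := boolP (na \in I); first by exists na; rewrite // !inE eqxx.
    have [pI|pI] := boolP (inX p \in I); first by exists (inX p); rewrite // !inE eqxx orbT.
    case: sepa; apply: codeC; rewrite (mI None t na) // (mI None t (inX p)) //.
    apply: codeC; apply: twa; first by case: (t) tz.
      by apply: contraNneq aI => <-.
    by apply: contraNneq pI => <-.
  have [b' b'E b'I] : exists2 b', b' \in [:: nb; inX q] & b' \in I.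
    have [aI|aI] := boolP (nb \in I); first by exists nb; rewrite // !inE eqxx.
    have [pI|pI] := boolP (inX q \in I); first by exists (inX q); rewrite // !inE eqxx orbT.
    case: sepb; apply: codeC; rewrite (mI None t nb) // (mI None t (inX q)) //.
    apply: codeC; apply: twb; first by case: (t) tz.
      by apply: contraNneq aI => <-.
    by apply: contraNneq pI => <-.
  exact: K a'E b'E a'I b'I.
have Fa c : na \in I -> inX c \in I -> False.
  move=> aI cI; case: sepa; apply: mI => //; by rewrite (Ga c).
have Fb c : nb \in I -> inX c \in I -> False.
  move=> aI cI; case: sepb; apply: mI => //; by rewrite (Gb c).
have Fab : na \in I -> nb \in I -> False.
  by move=> aI bI; apply: (K na nb) => //; rewrite !inE eqxx.
case: e e' eI e'I ee' => [[[x|]|]|] [[[y|]|]|] eI e'I ee';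
  try by [rewrite ?eqxx in ee' | rewrite ?eI ?e'I in zI
         | exact: Fab | exact: Fa eI e'I | exact: Fa e'I eI
         | exact: Fb eI e'I | exact: Fb e'I eI].
by case/eqP: ee'; rewrite (J1 x y).
Qed.

(* na is the clone of q, nb the trivial element and None the new one. *)
Lemma simple_clone_trivial (S : finType) (s : rel S) (q : S) k
    (r : rel (option (option (option S)))) :
  simple_rel s -> 2 < #|S| ->
  (forall x y, code r (inX x) (inX y) = code s x y) ->
  (forall x, x != q -> code r (inX x) na = code s x q) ->
  (forall x, code r nb (Some (Some x)) = k) ->
  code r nb None <> k ->
  code r None na <> code r None (inX q) ->
  (exists x y, code r None (inX x) <> code r None (inX y)) ->
  simple_rel r.
Proof.
move=> simp cS rE aw bk zk sepa [x0 [y0 zn]] I mI.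
have mJ : module s ((fun x => inX x) @^-1: I) by exact: preim_module mI.
have [w1 [w2 [w1q w2q qn]]] := simple_not_uniform q simp cS.
have an : code r na (inX w1) <> code r na (inX w2).
  move=> E; apply: qn; apply: codeC; rewrite -!aw //; exact: codeC E.
case: (simp _ mJ) => [|JT]; last first.
  have Is x : inX x \in I by move: (in_setT x); rewrite -JT inE.
  have aI : na \in I by apply/negPn/negP => nI; apply: an; exact: mI.
  have zI : None \in I by apply/negPn/negP => nI; apply: zn; exact: mI.
  right; apply/setP => -[[[x|]|]|]; rewrite inE ?Is //.
  (* From outside [I], [nb] would have to compare with [None] as with the other points. *)
  apply/negPn/negP => nI; apply: zk; rewrite -(bk (Some q)); exact: mI.
move/card_le1_eqP => J1; left.
have {}J1 x y : inX x \in I -> inX y \in I -> x = y.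
  by move=> xI yI; apply: J1; rewrite inE.
have Jn x w : inX x \in I -> w != x -> inX w \notin I.
  by move=> xI; apply: contra_neqN => wI; exact: J1.
(* Points of [S] outside [I] compare with [nb] by [k], hence also with every other member of an
   interval containing [nb]. This excludes each possible companion of [nb]. *)
have same_k x : nb \in I -> x \in I -> 
  forall w w', inX w \notin I -> inX w' \notin I -> code r x (inX w) = code r x (inX w').
  move=> bI xI w w' wI w'I; have E v : inX v \notin I -> code r x (inX v) = k.
    by move=> vI; rewrite -(bk (Some v)); apply: codeC; exact: mI.
  by rewrite !E.
have Fbx x : nb \in I -> inX x \in I -> False.
  move=> bI xI; have [w [w' [wx w'x]]] := simple_not_uniform x simp cS; apply.
  by rewrite -!rE; apply: same_k => //; exact: Jn xI _.
have bJ : nb \in I -> forall w, inX w \notin I.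
  by move=> bI w; apply/negP; exact: Fbx.
have Fba : nb \in I -> na \in I -> False.
  by move=> bI aI; apply: an; apply: same_k => //; exact: bJ.
have Fbz : nb \in I -> None \in I -> False.
  by move=> bI aI; apply: zn; apply: same_k => //; exact: bJ.
(* [nb] distinguishes [None] from the other points, so an interval with [None] and one of these
   would contain [nb]. *)
have Fz x : None \in I -> Some (Some x) \in I -> False.
  move=> zI xI; apply: zk; rewrite -(bk x); apply: mI => //.
  apply/negP => bI; exact: Fbz.
have Fax x : na \in I -> inX x \in I -> False.
  move=> aI xI; have [xq|xq] := eqVneq q x.
    apply: sepa; apply: mI => //; first by rewrite xq.
    apply/negP => zI; exact: Fz zI xI.
  have [w [wp wc]] := simple_no_twin simp cS xq; apply.
  by rewrite -(aw w wp) -(rE w x); apply: mI => //; exact: Jn xI _.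
apply: card_le1_of => e e' eI e'I ee'.
case: e e' eI e'I ee' => [[[x|]|]|] [[[y|]|]|] eI e'I ee';
  try by [rewrite ?eqxx in ee' | exact: Fz eI e'I | exact: Fz e'I eI
         | exact: Fba | exact: Fbz | exact: Fbx eI e'I | exact: Fbx e'I eI
         | exact: Fax eI e'I | exact: Fax e'I eI].
by case/eqP: ee'; rewrite (J1 x y).
Qed.

(** * One point separating two pairs of twins *)

(* If x < u, take the cut between the down-set of x and the up-set of v; if the
   pairs are incomparable, take a point below y and v only. *)
Lemma separate_two_twins (T : finType) (r : rel T) (x y u v : T) :
  strict r -> uniq [:: x; y; u; v] ->
  twin r predT x y -> twin r predT u v ->
  exists D U : pred T, [/\ oext_ok r D U, (U x, D x) <> (U y, D y)
                         & (U u, D u) <> (U v, D v)].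
Proof.
move=> [irr tr].
have asym a b : r a b -> r b a = false.
  by move=> ab; apply/negP => /(tr _ _ _ ab); rewrite irr.
(* The members of a pair may be exchanged, so [x] is not above [y], and likewise [u] is not above
   [v] below. *)
wlog yx : x y / ~~ r y x.
  move=> H un txy tuv; case: (boolP (r y x)) => [ryx|]; last by move=> nyx; exact: H.
  have [|||//|D [U [? ? ?]]] := H y x.
  - by rewrite asym.
  - by move: un; rewrite /= !inE !negb_or [y == x]eq_sym => /and4P[/and3P[-> -> ->] /andP[-> ->] ->].
  - exact: twinC.
  by exists D, U; split => // E; auto.
wlog vu : u v / ~~ r v u.
  move=> H un txy tuv; case: (boolP (r v u)) => [ryx|]; last by move=> nyx; exact: H.
  have [|||//|D [U [? ? ?]]] := H v u.
  - by rewrite asym.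
  - by move: un; rewrite /= !inE !negb_or [v == u]eq_sym => /and4P[/and3P[-> -> ->] /andP[-> ->] ->].
  - exact: txy.
  - exact: twinC.
  by exists D, U; split => // E; auto.
(* The new point is above [a] but not [b], and below [e] but not [c]. The cut is consistent: a < c
   gives a < e, because [c] and [e] are twins. *)
have low a b c e : ~~ r b a -> ~~ r e c -> a != b -> a != c -> a != e -> c != e ->
    twin r predT c e -> r a c ->
    exists D U : pred T, [/\ oext_ok r D U, (U a, D a) <> (U b, D b)
                         & (U c, D c) <> (U e, D e)].
  move=> ba ec ab ac ae ce tce rac.
  have rae : r a e by have [] := tce a isT ac ae; rewrite rac => <-.
  exists [pred w | (w == a) || r w a], [pred w | (w == e) || r e w].
  rewrite /= !eqxx [b == a]eq_sym (negPf ab) (negPf ba) (negPf ec) (negPf ce).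
  split; [split=> /= w w' rw|by case|by case].
  - by case/orP=> [/eqP <-|r']; rewrite ?rw ?orbT // (tr _ _ _ rw r') orbT.
  - by case/orP=> [/eqP <-|r']; rewrite ?rw ?orbT // (tr _ _ _ r' rw) orbT.
  - case/orP: rw => [/eqP->|rw] /orP[/eqP->|rw'] //.
    + exact: tr rae rw'.
    + exact: tr rw rae.
    + exact: tr rw (tr _ _ _ rae rw').
rewrite /= !inE !negb_or => /and4P[/and3P[xy xu xv] /andP[yu yv] uv _] txy tuv.
have [rxu|nxu] := boolP (r x u); first exact: (low x y u v).
have [rux|nux] := boolP (r u x).
  have [||||D [U [? ? ?]]] := low u v x y _ _ uv _ _ xy txy rux;
    rewrite 1?eq_sym //.
  by exists D, U; split.
(* [x] and [u] stay outside this up-set: [y] is not below [u] because [x] is not, and [v] is not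
   below [x] because [u] is not. *)
exists pred0, [pred w | [|| w == y, w == v, r y w | r v w]].
have nyu : ~~ r y u by rewrite eq_sym in xu; rewrite eq_sym in yu; have [_ <-] := txy u isT xu yu.
have nvx : ~~ r v x by have [_ <-] := tuv x isT xu xv.
rewrite /= !eqxx (negPf xy) (negPf xv) (negPf yx) (negPf nvx) [u == y]eq_sym.
rewrite (negPf yu) (negPf uv) (negPf nyu) (negPf vu) !orbT.
split; [split=> //= w w' rw|by case|by case].
case/or4P => [/eqP <-|/eqP <-|r'|r']; rewrite ?rw ?orbT //.
- by rewrite (tr _ _ _ r' rw) !orbT.
- by rewrite (tr _ _ _ r' rw) !orbT.
Qed.

(** * Embeddings and extensible subsets *)

Definition embeds (T S : eqType) (r : rel T) (X : pred T) (s : rel S)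
    (f : T -> S) :=
  {in X &, injective f} /\ {in X &, forall x y, s (f x) (f y) = r x y}.

(* [f] is only meaningful on [X]; larger sets are reached by redefining it. *)
Definition extensible (T : finType) (r : rel T) (X : {set T}) :=
  exists (S : finType) (s : rel S) (f : T -> S),
    [/\ strict s, simple_rel s, 3 < #|S| <= #|X| + uphalf #|X|.+1
      & embeds r (mem X) s f].

Lemma embeds_Some (T S : eqType) (r : rel T) (X : pred T) (s : rel S)
    (f : T -> S) (D U : pred S) :
  embeds r X s f -> embeds r X (oext s D U) (fun x => Some (f x)).
Proof. by move=> [inj fE]; split=> // x y xX yX [] /inj->. Qed.

Lemma embeds_oext (T S : eqType) (r : rel T) (X Y : pred T) (s : rel S)
    (f : T -> S) (a : T) (D U : pred S) :
  irreflexive r -> (forall x, x \in Y -> x != a -> x \in X) ->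
  embeds r X s f ->
  (forall x, x \in X -> D (f x) = r x a) ->
  (forall x, x \in X -> U (f x) = r a x) ->
  embeds r Y (oext s D U) (fun x => if x == a then None else Some (f x)).
Proof.
move=> irr YX [inj fE] DE UE; split=> x y xY yY.
  case: eqP => [->|/eqP xa]; case: eqP => [->|/eqP ya] // -[].
  by apply: inj; exact: YX.
case: eqP => [->|/eqP xa]; case: eqP => [->|/eqP ya] //=.
- by apply: UE; exact: YX.
- by apply: DE; exact: YX.
- by apply: fE; exact: YX.
Qed.

(** Reversing a relation keeps its intervals. This turns a least element into a greatest one. *)
Lemma extensible_converse (T : finType) (r : rel T) (X : {set T}) :
  extensible (fun x y => r y x) X -> extensible r X.
Proof.
move=> [S [s [f [[irr tr] simp cS [inj fE]]]]].
exists S, (fun x y => s y x), f; split=> //.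
- by split=> // y x z xy yz; exact: tr yz xy.
- by move=> I mI; apply: simp => x y w xI yI wI; rewrite /code; have [-> ->] := mI _ _ _ xI yI wI.
- by split=> // x y xX yX; exact: fE.
Qed.

(** * Adding back an element without twins *)

(** For a strict order the kind [k] is [(true, false)] if [a] is least, [(false, true)] if it is
    greatest and [(false, false)] if it is isolated. *)
Definition trivial_in (T : eqType) (r : rel T) (X : pred T) (a : T) k :=
  forall w, X w -> w != a -> code r a w = k.

Lemma extensible_free (T : finType) (r : rel T) (X : {set T}) (a : T) :
  strict r -> a \in X ->
  (forall q, q \in X -> q != a -> ~ twin r (mem X) a q) ->
  (forall k, ~ trivial_in r (mem X) a k) ->
  extensible r (X :\ a) -> extensible r X.
Proof.
move=> [irr tr] aX notw nt [S [s [f [[sirr str] simp /andP[cS cS'] [inj fE]]]]].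
have cX : #|X| = #|X :\ a|.+1 by rewrite (cardsD1 a X) aX.
have XI x : x \in X -> x != a -> x \in X :\ a by rewrite !inE => -> ->.
(* The least sets that transitivity forces below and above the new point, given the place of [a] in
   [X]. *)
pose D := [pred w | [exists p, [&& p \in X :\ a, r p a & (w == f p) || s w (f p)]]].
pose U := [pred w | [exists p, [&& p \in X :\ a, r a p & (w == f p) || s (f p) w]]].
have DE x : x \in X :\ a -> D (f x) = r x a.
  move=> xX; apply/existsP/idP => [[p /and3P[pX pa /orP[/eqP/inj->|]]]|xa] //.
    by rewrite fE // => /tr; exact.
  by exists x; rewrite xX xa eqxx.
have UE x : x \in X :\ a -> U (f x) = r a x.
  move=> xX; apply/existsP/idP => [[p /and3P[pX pa /orP[/eqP/inj->|]]]|xa] //.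
    by rewrite fE //; exact: tr.
  by exists x; rewrite xX xa eqxx.
have ok : oext_ok s D U.
  split=> [x y sxy /existsP[p /and3P[pX pa yp]]|x y sxy /existsP[p /and3P[pX pa yp]]|].
  - apply/existsP; exists p; rewrite pX pa /=.
    by case/orP: yp => [/eqP<-|/(str _ _ _ sxy)->]; rewrite ?sxy orbT.
  - apply/existsP; exists p; rewrite pX pa /=.
    by case/orP: yp => [/eqP<-|yp]; rewrite ?sxy ?(str _ _ _ yp sxy) orbT.
  - move=> x y /existsP[p /and3P[pX pa xp]] /existsP[q /and3P[qX aq qy]].
    have pq : s (f p) (f q) by rewrite fE //; exact: tr pa aq.
    have {}xp : s x (f q) by case/orP: xp => [/eqP->|/str]; last exact.
    by case/orP: qy => [/eqP->|] //; exact: str.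
(* Such a [q] would be a twin of the new point. It is not in the image of X - a, as [a] has no twin,
   so [a] can be sent to [q] without enlarging [S]. *)
case: (pickP [pred q | [forall w, (w != q) ==> (code s w q == (D w, U w))]])
    => [q /forallP qE|none].
  have {}qE w : w != q -> code s w q = (D w, U w).
    by move=> wq; apply/eqP; exact: (implyP (qE w)).
  have qim x : x \in X :\ a -> f x != q.
    move=> xX; apply/eqP => fx; move: (xX); rewrite !inE => /andP[xa xX'].
    apply: (notw x xX' xa) => w /= wX wa wx.
    have wX2 := XI _ wX wa.
    have wq : f w != q by rewrite -fx; apply: contra_neq wx => /inj->.
    move: (qE _ wq); rewrite DE // UE // => E.
    by rewrite /code -E -fx /code !fE.
  exists S, s, (fun x => if x == a then q else f x); split=> //.
    rewrite cS (leq_trans cS') // cX; lia.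
  split=> x y xX yX.
    case: eqP => [->|/eqP xa]; case: eqP => [->|/eqP ya] //.
    - by move/esym/eqP; rewrite (negPf (qim _ (XI _ yX ya))).
    - by move/eqP; rewrite (negPf (qim _ (XI _ xX xa))).
    - by apply: inj; exact: XI.
  case: eqP => [->|/eqP xa]; case: eqP => [->|/eqP ya] //.
  - by rewrite sirr irr.
  - by have [_ ->] := qE _ (qim _ (XI _ yX ya)); apply: UE; exact: XI.
  - by have [-> _] := qE _ (qim _ (XI _ xX xa)); apply: DE; exact: XI.
  - by apply: fE; exact: XI.
exists (option S), (oext s D U), (fun x => if x == a then None else Some (f x)).
split.
- exact: oext_strict.
- apply: simple_oext => //; first exact: ltnW cS.
    (* If all of [S] compared alike with the new point, [a] would be trivial in [X]. *)
    case: (pickP [pred xy : S * S | (U xy.1, D xy.1) != (U xy.2, D xy.2)])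
        => [[x y] /eqP ?|H]; first by exists x, y.
    have /card_gt0P[x0 _] : 0 < #|S| by lia.
    case: (nt (U x0, D x0)) => w wX wa.
    rewrite /code -UE ?XI // -DE ?XI //; apply/eqP.
    by move: (H (f w, x0)) => /= /negbFE.
  move=> q; have /forallPn[w] := negbT (none q).
  by rewrite negb_imply => /andP[wq /eqP wE]; exists w.
- by rewrite card_option; lia.
- by apply: embeds_oext (conj inj fE) DE UE => // x xX; exact: XI.
Qed.

(** * Adding back clones *)

(* The new point [None] copies [p]; [lo] and [up] place it below or above [p]. *)
Definition clone_ext (S : eqType) (s : rel S) (p : S) (lo up : bool) :=
  oext s [pred w | s w p || (w == p) && up] [pred w | s p w || (w == p) && lo].

Lemma clone_ext_strict (S : eqType) (s : rel S) p lo up :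
  strict s -> ~~ (lo && up) -> strict (clone_ext s p lo up).
Proof.
move=> st nlu; have [irr tr] := st; apply: oext_strict => //; split=> x y /=.
- by move=> xy /orP[/(tr _ _ _ xy)->|/andP[/eqP<-]]; rewrite ?xy.
- by move=> xy /orP[/tr ->|/andP[/eqP<-]]; rewrite ?xy.
- move=> /orP[xp|/andP[/eqP-> hu]] /orP[py|/andP[/eqP-> hl]] //.
    exact: tr xp py.
  by move: nlu; rewrite hu hl.
Qed.

Lemma clone_ext_code (S : eqType) (s : rel S) p lo up w :
  w != p -> code (clone_ext s p lo up) (Some w) None = code s w p.
Proof. by move=> /negPf wp; rewrite /code /= wp !orbF. Qed.

(** Away from [p] the clone compares as [a] does, by twinness; the flags [r a p] and [r p a] restore
    the order between [a] and [p]. *)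
Lemma embeds_clone (T S : eqType) (r : rel T) (X Y : pred T) (s : rel S)
    (f : T -> S) (a p : T) :
  irreflexive r -> irreflexive s -> p \in X ->
  (forall x, x \in Y -> x != a -> x \in X) -> a \notin X ->
  twin r X a p -> embeds r X s f ->
  embeds r Y (clone_ext s (f p) (r a p) (r p a))
    (fun x => if x == a then None else Some (f x)).
Proof.
move=> irr sirr pX YX aX tw em; have [inj fE] := em.
have aw x : x \in X -> x != p -> code r x a = code r x p.
  by move=> xX xp; apply: tw => //; apply: contraNneq aX => <-.
have H x : x \in X -> (s (f x) (f p) || (f x == f p) && r p a = r x a) *
                      (s (f p) (f x) || (f x == f p) && r a p = r a x).
  move=> xX; rewrite !fE // (inj_in_eq inj) //.
  have [->|xp] := eqVneq x p; first by rewrite irr.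
  by have [-> ->] := aw x xX xp; rewrite !orbF.
by apply: embeds_oext irr YX em _ _ => x xX; rewrite /= H.
Qed.

Lemma strict_asym (T : Type) (r : rel T) x y : strict r -> ~~ (r x y && r y x).
Proof. by move=> [irr tr]; apply/negP => /andP[/tr H /H]; rewrite irr. Qed.

(** Removing two elements lowers [uphalf #|X|.+1] by exactly one, which pays for the single point
    separating both pairs. *)
Lemma extensible_two_twins (T : finType) (r : rel T) (X : {set T}) a p b q :
  strict r -> [/\ a \in X, p \in X, b \in X & q \in X] ->
  uniq [:: a; p; b; q] ->
  twin r (mem X) a p -> twin r (mem X) b q ->
  extensible r (X :\ a :\ b) -> extensible r X.
Proof.
move=> st [aX pX bX qX] un twa twb [S [s [f [sst simp /andP[cS cS'] em]]]].
move: un; rewrite /= !inE !negb_or => /and4P[/and3P[ap ab aq] /andP[pb pq] bq _].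
have [irr tr] := st; have [sirr str] := sst; have [inj fE] := em.
set X2 := X :\ a :\ b in inj fE cS' em.
have cX : #|X| = #|X2|.+2 by rewrite (cardsD1 a X) (cardsD1 b (X :\ a)) aX !inE eq_sym ab bX.
have pX2 : p \in X2 by rewrite !inE pb eq_sym ap pX.
have qX2 : q \in X2 by rewrite !inE [q == b]eq_sym bq [q == a]eq_sym aq qX.
have pq' : f p != f q by apply: contra_neq pq; exact: inj.
set s1 := clone_ext s (f p) (r a p) (r p a).
set s2 := clone_ext s1 (Some (f q)) (r b q) (r q b).
have s1st : strict s1 by apply: clone_ext_strict => //; exact: strict_asym.
have s2st : strict s2 by apply: clone_ext_strict => //; exact: strict_asym.
have em1 : embeds r (mem (X :\ b)) s1 (fun x => if x == a then None else Some (f x)).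
  apply: embeds_clone em => //.
  - by move=> x; rewrite !inE => /andP[-> ->] ->.
  - by rewrite !inE eqxx andbF.
  - by move=> w /= wX; apply: twa; move: wX; rewrite !inE => /and3P[].
set f1 := (fun x => _) in em1.
have em2 : embeds r (mem X) s2 (fun x => if x == b then None else Some (f1 x)).
  have f1q : Some (f q) = f1 q by rewrite /f1 eq_sym (negPf aq).
  rewrite /s2 f1q; apply: embeds_clone em1 => //.
  - by case: s1st.
  - by rewrite !inE eq_sym bq.
  - by move=> x; rewrite !inE => -> ->.
  - by rewrite !inE eqxx.
  - by move=> w /= wX; apply: twb; move: wX; rewrite !inE => /andP[].
(* The second clone keeps the first pair twins: it compares with both members as [q] does, and [q]
   does not distinguish them. *)
have tw2a : twin s2 predT (Some None) (Some (Some (f p))).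
  move=> [[w|]|] _ // wa wp.
    by apply: (@clone_ext_code _ s); apply: contra_neq wp => ->.
  have := @clone_ext_code _ s (f p) (r a p) (r p a) (f q).
  rewrite eq_sym pq' => /(_ isT) E.
  have pq2 : (Some (f p) == Some (f q)) = false := negPf pq'.
  by rewrite /code /= pq2 !orbF; move: E; rewrite /code /= => -[-> ->].
have tw2b : twin s2 predT None (Some (Some (f q))).
  move=> [w|] // _ _ wq.
  by apply: clone_ext_code; apply: contra_neq wq => ->.
have [|D [U [ok sepa sepb]]] := separate_two_twins s2st _ tw2a tw2b.
  by rewrite /= !inE !andbT; apply: contra_neq pq' => -[].
exists (option (option (option S))), (oext s2 D U),
  (fun x => Some (if x == b then None else Some (f1 x))); split.
- exact: oext_strict.
- apply: (@simple_two_clones S s (f p) (f q)) => //; first exact: ltnW cS.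
    by move=> [w|] // _ wa wp; apply: tw2a.
  by move=> [w|] // _ wa wp; apply: tw2b.
- by rewrite !card_option; move: cS cS' cX; clear; lia.
- exact: embeds_Some.
Qed.

(** Here [a] is greatest or isolated. The new point is maximal; among the other points it is above
    those that are neither [q] nor above [q], and it is above [a] exactly if [a] is isolated.
    Extensibility is assumed for every choice of [b] because the proof may exchange [b] and [q]. *)
Lemma extensible_twin_trivial (T : finType) (r : rel T) (X : {set T}) a b q t :
  strict r -> [/\ a \in X, b \in X & q \in X] ->
  uniq [:: a; b; q] ->
  twin r (mem X) b q -> trivial_in r (mem X) a (false, t) ->
  (forall b q, b \in X -> q \in X -> b != a -> q != a ->
     extensible r (X :\ b :\ a)) -> extensible r X.
Proof.
move=> st; have [irr tr] := st.
wlog qb : b q / ~~ r q b.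
  move=> H [aX bX qX] un tw tri e; case: (boolP (r q b)) => [rqb|]; last first.
    by move=> nqb; exact: (H b q).
  apply: (H q b) => //; last exact: twinC.
    by apply: contraL (strict_asym q b st) => ->; rewrite rqb.
  by move: un; rewrite /= !inE [q == b]eq_sym orbC.
move=> [aX bX qX] un tw tri.
move: un; rewrite /= !inE !negb_or => /and3P[/andP[ab aq] bq _].
move/(_ b q bX qX); rewrite eq_sym ab eq_sym aq => /(_ isT isT).
move=> [S [s [f [sst simp /andP[cS cS'] em]]]].
have [sirr str] := sst; have [inj fE] := em.
set X2 := X :\ b :\ a in inj fE cS' em.
have cX : #|X| = #|X2|.+2.
  by rewrite (cardsD1 b X) (cardsD1 a (X :\ b)) !inE ab aX bX.
have qX2 : q \in X2 by rewrite !inE [q == b]eq_sym bq [q == a]eq_sym aq qX.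
set s1 := clone_ext s (f q) (r b q) (r q b).
set s2 := oext s1 [pred _ | t] pred0.
pose D0 := [pred w | (w != Some (f q)) && ~~ s1 (Some (f q)) w].
pose D := [pred w : option (option S) | if w is Some w then D0 w else ~~ t].
have s1st : strict s1 by apply: clone_ext_strict => //; exact: strict_asym.
have s2st : strict s2 by exact: oext_strict.
have em1 : embeds r (mem (X :\ a)) s1 (fun x => if x == b then None else Some (f x)).
  apply: embeds_clone em => //.
  - by move=> x; rewrite !inE => /andP[-> ->] ->.
  - by rewrite !inE eqxx andbF.
  - by move=> w /= wX; apply: tw; move: wX; rewrite !inE => /and3P[].
set f1 := (fun x => _) in em1.
have em2 : embeds r (mem X) s2 (fun x => if x == a then None else Some (f1 x)).
  apply: (embeds_oext irr _ em1).
  - by move=> x; rewrite !inE => -> ->.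
  - by move=> x; rewrite !inE => /andP[xa xX]; have [_ <-] := tri x xX xa.
  - by move=> x; rewrite !inE => /andP[xa xX]; have [<- _] := tri x xX xa.
have s3st : strict (oext s2 D pred0).
  have [irr1 tr1] := s1st.
  apply: oext_strict => //; split=> // -[x|] [y|] //; last by move=> /= ->.
  move=> xy /andP[yq qy]; apply/andP; split.
    by apply: contraNneq qy => <-.
  by apply: contra qy => qx; exact: tr1 qx xy.
exists (option (option (option S))), (oext s2 D pred0),
  (fun x => Some (if x == a then None else Some (f1 x))); split=> //.
- apply: (@simple_clone_trivial S s (f q) (false, t)) => //; first exact: ltnW cS.
  + by move=> x xq; exact: (@clone_ext_code _ s).
  + by rewrite /code /=; case: (t) => -[].
  + have D0q : D0 (Some (f q)) = false by rewrite /D0 /= eqxx.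
    have D0b : D0 None by rewrite /D0 /= sirr eqxx (negPf qb).
    by move=> E; have : D0 None = D0 (Some (f q)) := congr1 snd E; rewrite D0q D0b.
  (* Some point of [S] other than [q] is not above [q], since a least [q] would compare uniformly
     with the rest of [S]. *)
  + have [//||w [w' [wq w'q ww]]] := @simple_not_uniform S s (f q); first exact: ltnW cS.
    case: (pickP [pred x | (x != f q) && ~~ s (f q) x]) => [x /andP[xq qx]|none].
      have D0q : D0 (Some (f q)) = false by rewrite /D0 /= eqxx.
      have D0x : D0 (Some x) by apply/andP; split=> //; apply: contra_neq xq => -[].
      exists (f q), x => E.
      by have : D0 (Some (f q)) = D0 (Some x) := congr1 snd E; rewrite D0q D0x.
    case: ww; have E x : x != f q -> code s (f q) x = (true, false).
      move=> xq; have := none x; rewrite /= xq /= => /negbFE qx.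
      by rewrite /code qx; move: (strict_asym (f q) x sst); rewrite qx /= => /negPf->.
    by rewrite !E.
- by rewrite !card_option; move: cS cS' cX; clear; lia.
- exact: embeds_Some.
Qed.

(** * Case distinction from four elements on *)

(** Given one pair of twins, two further elements yield a trivial element or a second, disjoint
    pair. Without twins, failure of the first case makes every element trivial, and trivial elements
    of the same kind would be twins. *)
Lemma twin_trichotomy (T : finType) (r : rel T) (X : {set T}) :
  strict r -> 3 < #|X| ->
  [\/ exists2 a, a \in X & (forall q, q \in X -> q != a -> ~ twin r (mem X) a q)
        /\ forall k, ~ trivial_in r (mem X) a k,
      exists a p b q, [/\ [/\ a \in X, p \in X, b \in X & q \in X],
        uniq [:: a; p; b; q], twin r (mem X) a p & twin r (mem X) b q]
    | exists a b q k, [/\ [/\ a \in X, b \in X & q \in X], uniq [:: a; b; q],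
        twin r (mem X) b q & trivial_in r (mem X) a k]].
Proof.
move=> st cX; have [irr tr] := st.
pose tw x y := [forall w in X, (w != x) && (w != y) ==> (code r w x == code r w y)].
have twP x y : reflect (twin r (mem X) x y) (tw x y).
  apply: (iffP forall_inP) => H w wX; last by apply/implyP => /andP[wx wy]; rewrite H.
  by move=> wx wy; apply/eqP; apply: (implyP (H w wX)); rewrite wx.
pose nt x := [forall k, ~~ [forall w in X, (w != x) ==> (code r x w == k)]].
have ntP x : reflect (forall k, ~ trivial_in r (mem X) x k) (nt x).
  apply: (iffP forallP) => [H k tri|H k].
    case/negP: (H k); apply/forall_inP => w wX; apply/implyP => wx; apply/eqP; exact: tri.
  apply/negP => /forall_inP tri; apply: (H k) => w wX wx; apply/eqP.
  exact: (implyP (tri w wX)).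
case: (pickP [pred a in X | [forall q in X, (q != a) ==> ~~ tw a q] && nt a])
    => [a /and3P[aX /forall_inP H /ntP na]|none1].
  constructor 1; exists a => //; split=> // q qX qa /twP aq.
  by have := implyP (H q qX) qa; rewrite aq.
have dich a : a \in X -> (exists q, [/\ q \in X, q != a & tw a q]) \/
    exists k, trivial_in r (mem X) a k.
  move=> aX; have := none1 a; rewrite /= aX /= => /nandP[|].
    by case/forall_inPn => q qX; rewrite negb_imply negbK => /andP[qa aq]; left; exists q.
  case/forallPn => k /negPn/forall_inP H; right; exists k => w wX wa; apply/eqP.
  exact: (implyP (H w wX)).
have pick_out (s : seq T) : size s <= 3 -> exists2 x, x \in X & x \notin s.
  move=> ss; case: (pickP [pred x in X | x \notin s]) => [x /andP[]|none]; first by exists x.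
  have /subset_leq_card : X \subset s.
    by apply/subsetP => x xX; move: (none x); rewrite /= xX => /negbFE.
  by move=> H; have := leq_trans (leq_trans H (card_size s)) ss; rewrite leqNgt cX.
have [[b [q [bX qX bq twbq]]]|notw] : (exists b q, [/\ b \in X, q \in X, b != q & tw b q]) \/
   (forall b q, b \in X -> q \in X -> b != q -> ~~ tw b q).
- case: (pickP [pred z : T * T | [&& z.1 \in X, z.2 \in X, z.1 != z.2 & tw z.1 z.2]])
    => [[x y] /and4P[]|H]; first by left; exists x, y.
  right=> b q bX qX bq; apply/negP => t; by have := H (b, q); rewrite /= bX qX bq t.
- have twC x y : tw x y -> tw y x by move/twP/twinC/twP.
  have nontriv a : a \in X -> a != b -> a != q -> forall k, trivial_in r (mem X) a k ->
     exists a b q k, [/\ [/\ a \in X, b \in X & q \in X], uniq [:: a; b; q],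
        twin r (mem X) b q & trivial_in r (mem X) a k].
    move=> aX ab aq k tk; exists a, b, q, k; split=> //; last exact/twP.
    by rewrite /= !inE negb_or ab aq bq.
  have pair a p c e : a \in X -> p \in X -> c \in X -> e \in X ->
      uniq [:: a; p; c; e] -> tw a p -> tw c e ->
      exists a p b q, [/\ [/\ a \in X, p \in X, b \in X & q \in X],
        uniq [:: a; p; b; q], twin r (mem X) a p & twin r (mem X) b q].
    by move=> *; exists a, p, c, e; split=> //; apply/twP.
  have [e eX] := pick_out [:: b; q] isT; rewrite !inE negb_or => /andP[eb eq].
  have [g gX] := pick_out [:: b; q; e] isT; rewrite !inE !negb_or => /and3P[gb gq ge].
  (* An element outside the pair that is not trivial has a twin; if that twin is neither [b] nor
     [q], there are two disjoint pairs. *)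
  have out x : x \in X -> x != b -> x != q ->
      (tw x b || tw x q) \/ [\/ exists a p b q, [/\ [/\ a \in X, p \in X, b \in X & q \in X],
        uniq [:: a; p; b; q], twin r (mem X) a p & twin r (mem X) b q]
    | exists a b q k, [/\ [/\ a \in X, b \in X & q \in X], uniq [:: a; b; q],
        twin r (mem X) b q & trivial_in r (mem X) a k]].
    move=> xX xb xq; have [[y [yX yx xy]]|[k tk]] := dich x xX; last first.
      by right; right; exact: nontriv tk.
    have [yb|yb] := eqVneq y b; first by left; rewrite -yb xy.
    have [yq|yq] := eqVneq y q; first by left; rewrite -yq xy orbT.
    right; left; apply: (pair x y b q) => //.
    by rewrite /= !inE !negb_or eq_sym yx xb xq yb yq bq.
  (* three twins of the same element form an antichain, hence are twins of each other *)
  have star c d : c \in X -> d \in X -> c != d -> e != c -> g != c -> e != d -> g != d ->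
      tw c d -> tw e c -> tw g c ->
      exists a p b q, [/\ [/\ a \in X, p \in X, b \in X & q \in X],
        uniq [:: a; p; b; q], twin r (mem X) a p & twin r (mem X) b q].
    move=> cX' dX cd ec gc ed gd /twP tcd /twP tec /twP tgc.
    have E1 := tcd e eX ec ed.
    have E2 := tec d dX; rewrite eq_sym ed eq_sym cd in E2; have {}E2 := E2 isT isT.
    have E3 := tcd g gX gc gd.
    have E4 := tgc d dX; rewrite eq_sym gd eq_sym cd in E4; have {}E4 := E4 isT isT.
    have E5 := tec g gX ge gc.
    have E6 := tgc e eX; rewrite eq_sym ge ec in E6; have {}E6 := E6 isT isT.
    apply: (pair d e g c) => //; last exact/twP.
      by rewrite /= !inE !negb_or [d == e]eq_sym ed [d == g]eq_sym gd eq_sym cd eq_sym ge ec gc.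
    apply/twP => w wX wd we; have [wc|wc] := eqVneq w c; last first.
      by rewrite -(tcd w wX wc wd) (tec w wX we wc).
    rewrite wc; move: E1 E2 E3 E4 E5 E6.
    rewrite /code => -[-> ->] [-> ->] -[-> ->] [] *; congruence.
  have [|t] := out e eX eb eq; last by case: t => ?; [constructor 2 | constructor 3].
  have [|t] := out g gX gb gq; last by case: t => ?; [constructor 2 | constructor 3].
  move=> gt et; constructor 2.
  case/orP: gt => gt; case/orP: et => et.
  + exact: (star b q).
  + apply: (pair e q g b) => //.
    by rewrite /= !inE !negb_or eq eb [e == g]eq_sym ge eq_sym gq eq_sym bq gb.
  + apply: (pair e b g q) => //.
    by rewrite /= !inE !negb_or eq eb [e == g]eq_sym ge [b == g]eq_sym gb bq gq.
  + by apply: (star q b) => //; [rewrite eq_sym | exact: twC].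
- have tri x : x \in X -> exists k, trivial_in r (mem X) x k.
    move=> xX; case: (dich x xX) => // -[y [yX yx t]].
    by rewrite eq_sym in yx; rewrite (negPf (notw x y xX yX yx)) in t.
  have ks x y k k' : x \in X -> y \in X -> x != y -> trivial_in r (mem X) x k ->
      trivial_in r (mem X) y k' -> k != k'.
    move=> xX yX xy kx ky; apply: contraNneq (notw x y xX yX xy) => E.
    by apply/twP => w wX wx wy; apply: codeC; rewrite kx // ky.
  have ntt x k : x \in X -> trivial_in r (mem X) x k -> k != (true, true).
    move=> xX kx; have [y yX] := pick_out [:: x] isT; rewrite inE => yx.
    apply/eqP => E; have := kx y yX yx; rewrite E => -[xy yx'].
    by have := strict_asym x y st; rewrite xy yx'.
  have [x xX _] := pick_out [::] isT.
  have [y yX] := pick_out [:: x] isT; rewrite inE => yx.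
  have [z zX] := pick_out [:: x; y] isT; rewrite !inE negb_or => /andP[zx zy].
  have [w wX] := pick_out [:: x; y; z] isT; rewrite !inE !negb_or => /and3P[wx wy wz].
  have [kx tx] := tri x xX; have [ky ty] := tri y yX.
  have [kz tz] := tri z zX; have [kw tw'] := tri w wX.
  (* Four elements would need four distinct kinds, but only three are left without
     [(true, true)]. *)
  move: (ks _ _ _ _ yX xX yx ty tx) (ks _ _ _ _ zX xX zx tz tx) (ks _ _ _ _ zX yX zy tz ty)
    (ks _ _ _ _ wX xX wx tw' tx) (ks _ _ _ _ wX yX wy tw' ty) (ks _ _ _ _ wX zX wz tw' tz)
    (ntt _ _ xX tx) (ntt _ _ yX ty) (ntt _ _ zX tz) (ntt _ _ wX tw').
  by clear tx ty tz tw'; case: kx ky kz kw => [[] []] [[] []] [[] []] [[] []].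
Qed.

(** * Posets with two or three elements *)

(* Its restriction to {0, 1, 2, 3} is the poset N. *)
Definition bull : rel nat :=
  fun i j => (i, j) \in [:: (0, 1); (0, 2); (3, 1); (0, 4); (4, 1)].

Fixpoint bit_seqs n : seq (seq bool) :=
  if n is n'.+1 then [seq b :: l | b <- [:: true; false], l <- bit_seqs n']
  else [:: [::]].

Lemma mem_bit_seqs l : l \in bit_seqs (size l).
Proof.
by elim: l => // b l IH; apply/allpairsP; exists (b, l); split=> //; case: b.
Qed.

Definition bits_module n (r : rel nat) l :=
  all (fun x => all (fun y => all (fun w =>
    [&& nth false l x, nth false l y & ~~ nth false l w] ==>
      (code r w x == code r w y)) (iota 0 n)) (iota 0 n)) (iota 0 n).

(** Subsets of ['I_n] become lists of booleans, so that simplicity of a concrete relation is settled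
    by evaluation. *)
Lemma simple_by_bits n (r : rel nat) :
  all (fun l => bits_module n r l ==> (count id l <= 1) || all id l) (bit_seqs n) ->
  simple_rel (fun i j : 'I_n => r i j).
Proof.
move=> /allP chk I mI; pose l := [seq i \in I | i <- enum 'I_n].
have sl : size l = n by rewrite size_map size_enum_ord.
have nl (i : 'I_n) : nth false l i = (i \in I).
  by rewrite (nth_map i) ?size_enum_ord // nth_ord_enum.
have ml : bits_module n r l.
  apply/allP => x; rewrite mem_iota /= => xn; apply/allP => y; rewrite mem_iota /= => yn.
  apply/allP => w; rewrite mem_iota /= => wn; apply/implyP.
  rewrite (nl (Ordinal xn)) (nl (Ordinal yn)) (nl (Ordinal wn)) => /and3P[xI yI wI].
  by apply/eqP; exact: (mI _ _ _ xI yI wI).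
have := chk l; rewrite -{1}sl mem_bit_seqs ml => /(_ isT) /orP[H|H]; [left|right].
  by rewrite cardE /enum_mem size_filter; move: H; rewrite count_map enumT.
apply/setP => i; rewrite inE -nl; apply: (allP H); apply: mem_nth.
by rewrite sl.
Qed.

Lemma extensible_of_seq (T : finType) (r : rel T) (X : {set T}) n (v : seq nat) :
  simple_rel (fun i j : 'I_n.+1 => bull i j) ->
  3 < n.+1 <= #|X| + uphalf #|X|.+1 ->
  size v = #|X| -> uniq v -> all (fun i => i < n.+1) v ->
  (forall i j, i < #|X| -> j < #|X| -> forall x0,
    bull (nth 0 v i) (nth 0 v j) = r (nth x0 (enum X) i) (nth x0 (enum X) j)) ->
  extensible r X.
Proof.
move=> simp cn sv uv /allP vn vr.
pose f t : 'I_n.+1 := inord (nth 0 v (index t (enum X))).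
have ix t : t \in X -> index t (enum X) < #|X| by rewrite cardE index_mem mem_enum.
have fE t : t \in X -> f t = nth 0 v (index t (enum X)) :> nat.
  by move=> tX; rewrite inordK //; apply: vn; rewrite mem_nth // sv ix.
exists 'I_n.+1, (fun i j : 'I_n.+1 => bull i j), f; split=> //.
- split=> [[[|[|[|[|[|i]]]]] //]|].
  move=> y x z; rewrite /bull !inE !xpair_eqE.
  by move=> /or4P[|||/orP[]] /andP[/eqP-> /eqP->] //= /eqP->.
- by rewrite card_ord.
- split=> [x y xX yX /(congr1 val)|x y xX yX]; rewrite /= !fE //.
    move/eqP; rewrite nth_uniq ?sv ?ix // => /eqP H.
    by rewrite -(nth_index x (s := enum X) (x := x)) ?mem_enum // H nth_index ?mem_enum.
  by rewrite (vr _ _ _ _ x) ?ix // !nth_index ?mem_enum.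
Qed.

Lemma bull_pair (r12 r21 : bool) : ~~ (r12 && r21) ->
  exists i j, [/\ uniq [:: i; j], all (fun i => i < 4) [:: i; j],
    bull i j = r12 & bull j i = r21].
Proof.
by case: r12 r21 => [] [] // _; [exists 0, 1|exists 1, 0|exists 0, 3].
Qed.

(** The six implications are transitivity on three points. In [bull], 0 < 4 < 1 is a chain, {2, 3,
    4} an antichain, {0, 2, 3} has the single relation 0 < 2, and 0 is least in {0, 2, 4} and 1
    greatest in {0, 1, 3}, with the other two incomparable. *)
Lemma bull_triple (r12 r21 r13 r31 r23 r32 : bool) :
  [&& ~~ (r12 && r21), ~~ (r13 && r31), ~~ (r23 && r32),
      r12 && r23 ==> r13, r13 && r32 ==> r12, r21 && r13 ==> r23,
      r23 && r31 ==> r21, r31 && r12 ==> r32 & r32 && r21 ==> r31] ->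
  exists i j k, [/\ uniq [:: i; j; k], all (fun i => i < 5) [:: i; j; k],
    code bull i j = (r12, r21), code bull i k = (r13, r31)
    & code bull j k = (r23, r32)].
Proof.
move=> H.
have /hasP[i _ /hasP[j _ /hasP[k _]]] : has (fun i => has (fun j => has (fun k =>
    [&& uniq [:: i; j; k], all (fun i => i < 5) [:: i; j; k],
     code bull i j == (r12, r21), code bull i k == (r13, r31)
    & code bull j k == (r23, r32)]) (iota 0 5)) (iota 0 5)) (iota 0 5).
  by case: r12 r21 r13 r31 r23 r32 H => [] [] [] [] [] [].
by case/and5P => u a /eqP ? /eqP ? /eqP ?; exists i, j, k.
Qed.

(** The bound is 2 + 2 = 4 for two elements, the size of N, and 3 + 2 = 5 for three, the size of the
    bull. *)
Lemma extensible_small (T : finType) (r : rel T) (X : {set T}) :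
  strict r -> 1 < #|X| <= 3 -> extensible r X.
Proof.
move=> st; have [irr tr] := st; have asym := fun x y => strict_asym x y st.
rewrite cardE; case eX : (enum X) => [|x [|y [|z [|? ?]]]] //= _.
- have [i [j [u a ij ji]]] := bull_pair (asym x y).
  have cX : #|X| = 2 by rewrite cardE eX.
  apply: (@extensible_of_seq _ _ _ 3 [:: i; j]); rewrite ?cX //.
    exact: simple_by_bits.
  by rewrite eX => -[|[|//]] [|[|//]] _ _ x0 /=; rewrite ?irr ?ij ?ji //;
    case: (i) (j) a {ij ji u} => [|[|[|[|?]]]] [|[|[|[|?]]]].
- have imp a b c : r a b && r b c ==> r a c by apply/implyP => /andP[]; exact: tr.
  have [|i [j [k [u a [ij ji] [ik ki] [jk kj]]]]] :=
    @bull_triple (r x y) (r y x) (r x z) (r z x) (r y z) (r z y).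
    by rewrite !asym !imp.
  have cX : #|X| = 3 by rewrite cardE eX.
  have irrb m : bull m m = false by case: m => [|[|[|[|[|?]]]]].
  apply: (@extensible_of_seq _ _ _ 4 [:: i; j; k]); rewrite ?cX //.
    exact: simple_by_bits.
  by rewrite eX => -[|[|[|//]]] [|[|[|//]]] _ _ x0 /=; rewrite ?irr ?irrb.
Qed.

(** * The induction *)

(** Strong induction on the size of [X], for all relations at once because a least element is
    treated in the converse. From four elements on, removing one or two leaves at least two. *)
Lemma all_extensible (T : finType) (X : {set T}) (r : rel T) :
  strict r -> 1 < #|X| -> extensible r X.
Proof.
have [n] := ubnP #|X|; elim: n X r => // n IH X r Xn st X1.
have [X3|X3] := leqP #|X| 3; first by apply: extensible_small; rewrite ?X1.
have D1 a : a \in X -> #|X| = #|X :\ a|.+1 by move=> aX; rewrite (cardsD1 a) aX.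
have D2 a b : a \in X -> b \in X -> b != a -> #|X| = #|X :\ a :\ b|.+2.
  by move=> aX bX ba; rewrite (D1 a aX) (cardsD1 b) !inE ba bX.
have rem2 r' a b : strict r' -> a \in X -> b \in X -> b != a ->
    extensible r' (X :\ a :\ b).
  by move=> st' aX bX ba; have := D2 a b aX bX ba; move=> E; apply: IH => //; lia.
have [[a aX [ntw ntri]]|[a [p [b [q [[aX pX bX qX] un tap tbq]]]]]|] :=
  twin_trichotomy st X3.
- by have E := D1 a aX; apply: (extensible_free st aX) => //; apply: IH => //; lia.
- apply: (extensible_two_twins st _ un) => //.
  by apply: rem2 => //; move: un; rewrite /= !inE !negb_or [b == a]eq_sym => /andP[/and3P[]].
- move=> [a [b [q [[up t] [[aX bX qX] un tbq tri]]]]].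
  have tw_tri : forall r' t', strict r' -> twin r' (mem X) b q ->
      trivial_in r' (mem X) a (false, t') -> extensible r' X.
    move=> r' t' st' tw' tri'.
    apply: (extensible_twin_trivial (t := t') st' _ un) => //.
    by move=> b' q' b'X q'X b'a q'a; apply: rem2 => //; rewrite eq_sym.
  (* If [up] is true, [a] is least and becomes greatest in the converse. *)
  case: up tri => [|] tri; last exact: tw_tri tri.
  have ba : b != a by move: un; rewrite /= !inE !negb_or [b == a]eq_sym => /andP[/andP[]].
  have t0 : t = false.
    have [rab rba] := tri b bX ba; have := strict_asym a b st.
    by rewrite rab rba => /negPf.
  apply: extensible_converse; apply: (tw_tri _ true).
  + by have [irr tr] := st; split=> // y x z xy yz; exact: tr yz xy.
  + by move=> w wX wb wq; exact: codeC (tbq w wX wb wq).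
  + by move=> w wX wa; rewrite /code; have [-> ->] := tri w wX wa; rewrite t0.
Qed.

(** * Return to posets *)

Lemma simple_rel_bij (S Q : finType) (s : rel S) (r : rel Q) (g : S -> Q) :
  bijective g -> {mono g : x y / s x y >-> r x y} -> simple_rel s -> simple_rel r.
Proof.
move=> gb gE simp I mI.
have mJ : module s (g @^-1: I).
  by apply: preim_module mI => x y; rewrite /code !gE.
case: (simp _ mJ) => [J1|JT]; [left|right].
  by move: J1; rewrite on_card_preimset //; exact: onW_bij.
have [h _ gh] := gb; apply/setP => x.
by move: (in_setT (h x)); rewrite -JT !inE gh.
Qed.

(* The proof argument lets canonical structures recover the relation. *)
Definition strict_carrier (d : Order.disp_t) (S : finType) (s : rel S)
  (st : strict s) : Type := S.

HB.instance Definition _ d S s st := Finite.on (@strict_carrier d S s st).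

HB.instance Definition _ d S s st :=
  Order.Lt_isPOrder.Build d (@strict_carrier d S s st) (proj1 st) (proj2 st).

Lemma simple_poset_of_rel (d : Order.disp_t) (Q : finPOrderType d) :
  simple_rel (fun x y : Q => (x < y)%O) -> simple_poset Q.
Proof.
move=> simp I [mI I0 I1 IT]; case: (simp I) => [x y w xI yI wI||//].
  have [[xy yx] [xy' yx']] := mI x y w xI yI wI.
  by rewrite /code; congr (_, _); apply/idP/idP.
by rewrite leq_eqVlt ltnS leqn0 cards_eq0 => /orP[/cards1P[x /I1]|/eqP/I0].
Qed.

Theorem theorem5p1 (d : Order.disp_t) (P : finPOrderType d) (n : nat)
    (cardP : #|P| = n) (n_ge1 : 1 <= n) :
  exists (Q : finPOrderType d) (f : P -> Q),
    [/\ injective f,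
        #|~: (f @: [set: P])| <= uphalf n.+1,
        (forall x y : P, (f x < f y)%O = (x < y)%O)
      & simple_poset Q].
Proof.
(* A single element is already simple; [extensible] asks for four points, more than the bound allows
   here. *)
have [n1|n1] := leqP n 1.
  exists P, id; split=> //; first by rewrite imset_id setCT cards0.
  apply: simple_poset_of_rel => I _; left.
  by rewrite (leq_trans (max_card _)) // cardP.
have st : strict (fun x y : P => (x < y)%O).
  by split; [exact: ltxx | exact: lt_trans].
have [|S [s [f [sst simp /andP[_ cS] [inj fE]]]]] := @all_extensible P [set: P] _ st.
  by rewrite cardsT cardP.
have injf : injective f by move=> x y; apply: inj; rewrite inE.
pose Q : finPOrderType d := @strict_carrier d S s sst.
have idb : bijective (id : S -> Q) by exists id.
exists Q, f; split=> //.
(* The image of [f] has [n] points, so the bound on [S] leaves at most [uphalf n.+1] for its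
   complement. *)
- have := cardsC ((f : P -> Q) @: [set: P]).
  rewrite (card_imset (f := f : P -> Q)) // -(bij_eq_card idb) cardsT cardP => cE.
  by move: cS; rewrite cardsT cardP -cE leq_add2l.
- by move=> x y; apply: fE; rewrite inE.
- exact/simple_poset_of_rel/(simple_rel_bij idb _ simp).
Qed.
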